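(* Let $W$ be a Banach space and $a<b$ real numbers. For any $p\ge1$, the functional $\|\cdot\|_{p\text{-TV},[a,b]}$ is a seminorm and the functional $\|\cdot\|_{\mathrm{TV},p,[a,b]}$ is a norm on $\mathcal{U}^{p}([a,b],W)$. The space $\mathcal{U}^{p}([a,b],W)$ equipped with the norm $\|\cdot\|_{\mathrm{TV},p,[a,b]}$ is a Banach space.
   Context: For $f:[a,b]\to W$ and $\delta\ge0$, the truncated variation is $$\mathrm{TV}^{\delta}(f,[a,b]):=\sup_{n}\ \sup_{a\le t_{0}<t_{1}<\ldots<t_{n}\le b}\ \sum_{i=1}^{n}\max\{\|f(t_{i})-f(t_{i-1})\|_W-\delta,0\}.$$ $\mathcal{U}^{p}([a,b],W)$ is the family of functions $f:[a,b]\to W$ such that $\sup_{\delta>0}\delta^{p-1}\mathrm{TV}^{\delta}(f,[a,b])<+\infty$ (with pointwise operations). On it one defines $$\|f\|_{p\text{-TV},[a,b]}:=\left(\sup_{\delta>0}\delta^{p-1}\mathrm{TV}^{\delta}(f,[a,b])\right)^{1/p},\qquad \|f\|_{\mathrm{TV},p,[a,b]}:=\|f(a)\|_{W}+\|f\|_{p\text{-TV},[a,b]}.$$ *)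

(* Defs.v *)
From mathcomp Require Import all_boot all_order all_algebra.
From mathcomp Require Import all_classical all_reals all_analysis.
Set Implicit Arguments.
Unset Strict Implicit.
Unset Printing Implicit Defensive.
Import Order.TTheory GRing.Theory Num.Theory.
Import numFieldNormedType.Exports.
Local Open Scope classical_set_scope.
Local Open Scope ring_scope.

Notation Icc a b := {x | x \in `[a, b]}.

Lemma Icc_left_subproof (R : realType) (a b : R) : a < b -> a \in `[a, b].
Proof. by move=> ab; rewrite in_itv /= lexx ltW. Qed.

Definition Icc_left (R : realType) (a b : R) (ab : a < b) : Icc a b :=
  exist _ a (Icc_left_subproof ab).

Section truncated_variation.
Variables (R : realType) (W : normedModType R) (a b : R).
Implicit Types (f : Icc a b -> W) (d p : R).

(* Only the values t 0, ..., t n matter; the case n = 0 contributes the empty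
   sum 0. *)
Definition truncated_variation d f : \bar R :=
  ereal_sup [set v | exists (n : nat) (t : nat -> Icc a b),
    (forall i, (i < n)%N -> val (t i) < val (t i.+1)) /\
    v = (\sum_(1 <= i < n.+1)
           Num.max (`|f (t i) - f (t i.-1)| - d) 0)%:E].

Definition sup_truncated_variation p f : \bar R :=
  ereal_sup [set ((d `^ (p - 1))%:E * truncated_variation d f)%E
            | d in [set d : R | 0 < d]].

Definition Up p : set (Icc a b -> W) :=
  [set f | (sup_truncated_variation p f < +oo)%E].

(* Meaningful for f in Up p only: fine sends +oo to 0. *)
Definition pTV_seminorm p f : R :=
  fine (sup_truncated_variation p f) `^ p^-1.

Definition TVp_norm (ab : a < b) p f : R :=
  `|f (Icc_left ab)| + pTV_seminorm p f.

End truncated_variation.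

Arguments Up {R} W a b p.

Section norms_on_subspaces.
Variables (R : realType) (V : lmodType R).
Implicit Types (S : set V) (q : V -> R).

Definition linear_subspace S := submod_closed (mem S).

Definition seminorm_on S q :=
  [/\ forall x, S x -> 0 <= q x,
      forall (c : R) x, S x -> q (c *: x) = `|c| * q x
    & forall x y, S x -> S y -> q (x + y) <= q x + q y].

Definition norm_on S q :=
  seminorm_on S q /\ forall x, S x -> q x = 0 -> x = 0.

(* S, with the linear structure of V and the norm q, is a Banach space. The
   structure is carried by a type B, a copy of S embedded in V by i. *)
Definition banach_on S q :=
  exists (B : completeNormedModType R) (i : {linear B -> V}),
    [/\ injective i, range i = S & forall x, q (i x) = `|x| ].

End norms_on_subspaces.

(* Main.v *)
(* For A > 0, f satisfies ||f||_{p-TV} <= A iff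
   d^(p-1) TV^{d A}(f) <= A for all d > 0: the seminorm is the gauge of this
   condition. Since TV^{d A + d B}(f + g) <= TV^{d A}(f) + TV^{d B}(g), the
   condition is subadditive in (A, f), which gives the triangle inequality.
   Taking d = 1 and a subdivision {a, s} shows |f(s) - f(a)| <= 2 A, so the norm
   dominates the uniform norm; Cauchy filters converge pointwise, and the limit
   inherits the condition because each truncated sum is continuous for pointwise
   convergence. *)
From HB Require Import structures.
Require Import Defs.
From mathcomp Require Import all_boot all_order all_algebra.
From mathcomp Require Import all_classical all_reals all_analysis.
From mathcomp Require Import lra.
Set Implicit Arguments.
Unset Strict Implicit.
Unset Printing Implicit Defensive.
Import Order.TTheory GRing.Theory Num.Theory.
Import numFieldNormedType.Exports.
Local Open Scope classical_set_scope.
Local Open Scope ring_scope.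

(** * Normed type carried by a linear subspace *)

Section normed_subspace.
Variables (R : realType) (V : lmodType R) (S : set V) (q : V -> R).
Hypotheses (linS : linear_subspace S) (normq : norm_on S q).

(** The linearity proof is an argument so that the closure instance can be declared on this
    predicate. *)
Definition subspace_pred (_ : linear_subspace S) : {pred V} := mem S.

Lemma subspace_predP x : reflect (S x) (x \in subspace_pred linS).
Proof. exact: (iffP idP) (@set_mem _ _ _) (@mem_set _ _ _). Qed.

Lemma subspace_pred_subsemimod_closed : subsemimod_closed (subspace_pred linS).
Proof. exact: GRing.submod_closed_semi. Qed.

HB.instance Definition _ :=
  GRing.isSubmodClosed.Build R V (subspace_pred linS)
    subspace_pred_subsemimod_closed.

(* The norm is attached to the carrier so that instances depending on q can be
   declared on it. *)
Definition normed_subspace (_ : norm_on S q) :=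
  {x : V | x \in subspace_pred linS}.

HB.instance Definition _ := SubChoice.on (normed_subspace normq).
HB.instance Definition _ :=
  [SubChoice_isSubLmodule of normed_subspace normq by <:].

Local Notation B := (normed_subspace normq).

Lemma normed_subspaceP (x : B) : S (val x).
Proof. by apply/subspace_predP; exact: valP. Qed.

Let norm (x : B) := q (val x).

Lemma normed_subspaceD x y : norm (x + y) <= norm x + norm y.
Proof. have [[_ _ qD] _] := normq; apply: qD; exact: normed_subspaceP. Qed.

Lemma normed_subspaceZ c x : norm (c *: x) = `|c| * norm x.
Proof. have [[_ qZ _] _] := normq; apply: qZ; exact: normed_subspaceP. Qed.

Lemma normed_subspace_eq0 x : norm x = 0 -> x = 0.
Proof.
have [_ q0] := normq => x0; apply: val_inj => /=.
apply: q0 => //; exact: normed_subspaceP.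
Qed.

HB.instance Definition _ := Lmodule_isNormed.Build R B
  normed_subspaceD normed_subspaceZ normed_subspace_eq0.

(** Filters live on the ambient [V], so that completeness can be checked without the carrier
    type. *)
Definition norm_complete := forall F : set_system V, ProperFilter F -> F S ->
  (forall e, 0 < e -> exists2 x, S x & F [set y | q (x - y) < e]) ->
  exists2 x, S x & forall e, 0 < e -> F [set y | q (x - y) < e].

Lemma norm_complete_banach_on : norm_complete -> banach_on S q.
Proof.
move=> complq.
have cB (F : set_system B) : ProperFilter F -> cauchy F -> cvg F.
  move=> FF /cauchyP cF.
  (* The image filter under [val] contains [S] and is Cauchy for [q]. *)
  have [||x Sx Fx] :=
    complq (fun A => F (val @^-1` A)) (fmap_proper_filter val FF).
  - by apply: filterS filterT => x _; exact: normed_subspaceP.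
  - move=> e e0; have [x Fx] := cF e e0.
    exists (val x); first exact: normed_subspaceP.
    by move: Fx; rewrite -ball_normE.
  apply/cvg_ex; exists (exist _ x (introT (subspace_predP x) Sx) : B).
  by apply/cvgrPdist_lt => e; exact: Fx.
pose C : completeNormedModType R :=
  HB.pack_for (completeNormedModType R) B (Uniform_isComplete.Build B cB).
exists C, (val : {linear B -> V}); split.
- exact: val_inj.
- apply/seteqP; split => [_ [x _ <-]|x Sx]; first exact: normed_subspaceP.
  by exists (exist _ x (introT (subspace_predP x) Sx) : B).
- by [].
Qed.
End normed_subspace.

(** * Truncated sums and the gauge condition *)

Section truncated_sum.
Variables (R : realType) (W : normedModType R) (a b : R).
Implicit Types (f g : Icc a b -> W) (d p A B c : R).
Implicit Types (n : nat) (t : nat -> Icc a b).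

Definition subdivision n t := forall i, (i < n)%N -> val (t i) < val (t i.+1).

Definition truncated_sum d f n t : R :=
  \sum_(1 <= i < n.+1) Num.max (`|f (t i) - f (t i.-1)| - d) 0.

(** Termwise, from the triangle inequality and the subadditivity of the positive part. *)
Lemma truncated_sumD d1 d2 f g n t :
  truncated_sum (d1 + d2) (f + g) n t <=
  truncated_sum d1 f n t + truncated_sum d2 g n t.
Proof.
rewrite -big_split; apply: ler_sum => i _ /=.
set x := f _ - _; set y := g _ - _.
have -> : (f + g) (t i) - (f + g) (t i.-1) = x + y.
  by rewrite /x /y !fctE opprD addrACA.
have xy := ler_normD x y.
rewrite ge_max; apply/andP; split; last by rewrite addr_ge0// le_max lexx orbT.
have x1 : `|x| - d1 <= Num.max (`|x| - d1) 0 by rewrite le_max lexx.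
have y1 : `|y| - d2 <= Num.max (`|y| - d2) 0 by rewrite le_max lexx.
lra.
Qed.

Lemma truncated_sumZ d f n t c :
  truncated_sum (`|c| * d) (c *: f) n t = `|c| * truncated_sum d f n t.
Proof.
rewrite /truncated_sum big_distrr; apply: eq_bigr => i _ /=.
by rewrite !fctE -scalerBr normrZ -mulrBr maxr_pMr// mulr0.
Qed.

Lemma cvg_truncated_sum (F : set_system (Icc a b -> W)) (FF : Filter F) d g n t :
  (forall s, f s @[f --> F] --> g s) ->
  truncated_sum d f n t @[f --> F] --> truncated_sum d g n t.
Proof.
move=> Fg; apply: cvg_big => [|i _]; first exact: add_continuous.
have mc : continuous (fun x : R => Num.max (x - d) 0).
  move=> x; apply: (@continuous_max _ _ (fun x : R => x - d) (fun=> 0)).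
    by apply: cvgB; [exact: cvg_id|exact: cvg_cst].
  exact: cvg_cst.
apply: (@continuous_cvg _ _ _ _ _ _ (fun x : R => Num.max (x - d) 0) _ (mc _)).
by apply: cvg_norm; apply: cvgB.
Qed.

(* sup_d d^(p-1) TV^d(f) <= A^p after the substitution d := d * A. *)
Definition pTV_bound p A f := forall d n t, 0 < d -> subdivision n t ->
  d `^ (p - 1) * truncated_sum (d * A) f n t <= A.

Lemma sup_truncated_variation_leP p f A :
  (sup_truncated_variation p f <= A%:E)%E <->
  forall d n t, 0 < d -> subdivision n t ->
    d `^ (p - 1) * truncated_sum d f n t <= A.
Proof.
split=> [fA d n t d0 tn|fA].
  rewrite -lee_fin; apply: le_trans fA.
  apply: le_trans (ereal_sup_ubound _); last by exists d.
  rewrite EFinM lee_wpmul2l// ?lee_fin ?powR_ge0//.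
  by apply: ereal_sup_ubound; exists n, t.
apply: ge_ereal_sup => _ [d /= d0 <-].
rewrite -lee_pdivlMl ?powR_gt0//.
apply: ge_ereal_sup => _ [n [t [tn ->]]].
by rewrite lee_pdivlMl ?powR_gt0// -EFinM lee_fin; exact: fA.
Qed.

(** The trivial subdivision [n = 0] has sum 0; this rules out the value [-oo]. *)
Lemma sup_truncated_variation_ge0 p f : a < b ->
  (0 <= sup_truncated_variation p f)%E.
Proof.
move=> ab; apply: le_trans (ereal_sup_ubound _); last first.
  by exists 1; first exact: ltr01.
rewrite powR1 mul1e; apply: ereal_sup_ubound; exists 0%N, (fun=> Icc_left ab).
by split=> //; rewrite big_geq.
Qed.

(** Replacing [d] by [d * A] turns the bound by the [p]-th power of [A] into a bound by [A], since a
    factor [A] to the [p - 1] cancels; then [p]-th roots are taken. *)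
Lemma pTV_boundP p f A : a < b -> 1 <= p -> 0 < A ->
  pTV_bound p A f <-> Up W a b p f /\ pTV_seminorm p f <= A.
Proof.
move=> ab p1 A0.
have p0 : 0 < p by exact: lt_le_trans p1.
have -> : pTV_bound p A f <->
    (sup_truncated_variation p f <= (A `^ p)%:E)%E.
  rewrite sup_truncated_variation_leP.
  have homog d v : 0 < d ->
      ((d * A) `^ (p - 1) * v <= A `^ p) = (d `^ (p - 1) * v <= A).
    move=> d0; rewrite powRM ?(ltW d0) ?(ltW A0)// mulrAC.
    rewrite -[leRHS](mulr_powRB1 (ltW A0) p0).
    by rewrite ler_pM2r ?powR_gt0.
  split=> fA d n t d0 tn; last first.
    by rewrite -homog//; apply: fA => //; exact: mulr_gt0.
  rewrite -[d](divfK (lt0r_neq0 A0)) homog ?divr_gt0//.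
  by apply: fA => //; exact: divr_gt0.
have := sup_truncated_variation_ge0 p f ab.
rewrite /Up /pTV_seminorm /=; case: (sup_truncated_variation p f) => [r| |]//=.
- rewrite !lee_fin ltry => r0.
  split=> [rA|[_ rA]].
    split=> //.
    rewrite -[leRHS](powRr1 (ltW A0)) -[1 in leRHS](divff (lt0r_neq0 p0)) powRrM.
    by apply: ge0_ler_powR => //; rewrite ?nnegrE ?powR_ge0 ?invr_ge0// ltW.
  rewrite -[leLHS]powRr1// -[1 in leLHS](mulVf (lt0r_neq0 p0)) powRrM.
  by apply: ge0_ler_powR => //; rewrite ?nnegrE ?powR_ge0// ltW.
(* At [+oo] both sides fail: [Up] excludes the default value 0 of [fine]. *)
- by move=> _; split=> [|[]]; rewrite ?leye_eq ?ltxx.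
Qed.

Lemma pTV_seminorm_ge0 p f : 0 <= pTV_seminorm p f.
Proof. exact: powR_ge0. Qed.

Lemma pTV_boundD p A B f g :
  pTV_bound p A f -> pTV_bound p B g -> pTV_bound p (A + B) (f + g).
Proof.
move=> fA gB d n t d0 tn.
apply: le_trans (lerD (fA d n t d0 tn) (gB d n t d0 tn)).
by rewrite -mulrDr ler_wpM2l ?powR_ge0// mulrDr truncated_sumD.
Qed.

Lemma pTV_boundZ p A c f : pTV_bound p A f -> pTV_bound p (`|c| * A) (c *: f).
Proof.
move=> fA d n t d0 tn.
by rewrite mulrCA truncated_sumZ mulrCA ler_wpM2l// fA.
Qed.

Lemma pTV_bound0 p A : 0 <= A -> pTV_bound p A 0.
Proof.
move=> A0 d n t d0 tn; rewrite /truncated_sum big1 ?mulr0// => i _.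
by rewrite subrr normr0 sub0r max_r// oppr_le0 mulr_ge0// ltW.
Qed.

Lemma pTV_bound_closed (F : set_system (Icc a b -> W)) (FF : ProperFilter F)
    p A g :
  (forall s, f s @[f --> F] --> g s) -> F (pTV_bound p A) -> pTV_bound p A g.
Proof.
move=> Fg FA d n t d0 tn.
apply: (@cvgr_to_le _ F _ _
  (fun f => d `^ (p - 1) * truncated_sum (d * A) f n t)); last first.
  by apply: filterS FA => f fA; exact: fA.
by apply: cvgMr; exact: cvg_truncated_sum.
Qed.

Lemma pTV_bound_oscillation p A f (ab : a < b) s :
  pTV_bound p A f -> `|f s - f (Icc_left ab)| <= 2 * A.
Proof.
(* At the left endpoint only [0 <= A] is needed, and the empty sum gives it. *)
move=> fA; have [->|sa] := eqVneq s (Icc_left ab).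
  have := fA 1 0%N (fun=> s) ltr01.
  rewrite subrr normr0 powR1 mul1r /truncated_sum big_geq// => A0.
  by rewrite mulr_ge0// A0.
have as_ : a < val s.
  rewrite lt_neqAle; apply/andP; split; last first.
    by case: s {sa} => x /=; rewrite in_itv /= => /andP[].
  by apply: contraNneq sa => sa; apply/eqP/val_inj.
(* With [d = 1] the single term exceeds the threshold [A] by at most [A]. *)
have ts : subdivision 1 (fun i => if i is 0 then Icc_left ab else s) by case.
have := fA 1 _ _ ltr01 ts; rewrite powR1 !mul1r /truncated_sum big_nat1.
rewrite ge_max lerBlDr => /andP[+ _]; rewrite mulr_natl mulr2n.
exact.
Qed.

End truncated_sum.

(** * Seminorm and norm properties *)

Section pTV_seminorm_theory.
Variables (R : realType) (W : normedModType R) (a b : R).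
Hypothesis ab : a < b.
Variable p : R.
Hypothesis p1 : 1 <= p.
Implicit Types (f g : Icc a b -> W) (A c : R).

Local Notation Up := (Up W a b p).
Local Notation N := (@pTV_seminorm R W a b p).

(** The slack [e] keeps the gauge parameter positive when [N f = 0]. *)
Lemma pTV_bound_seminorm f e : Up f -> 0 < e -> pTV_bound p (N f + e) f.
Proof.
move=> Uf e0; apply/pTV_boundP => //; first by rewrite ltr_wpDl ?pTV_seminorm_ge0.
by split=> //; rewrite lerDl ltW.
Qed.

Lemma pTV_seminormD f g : Up f -> Up g -> Up (f + g) /\ N (f + g) <= N f + N g.
Proof.
move=> Uf Ug.
have fg e : 0 < e -> Up (f + g) /\ N (f + g) <= (N f + e / 2) + (N g + e / 2).
  move=> e0; have e20 : 0 < e / 2 by rewrite divr_gt0.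
  apply/pTV_boundP => //; last by apply: pTV_boundD; exact: pTV_bound_seminorm.
  by rewrite addr_gt0// ltr_wpDl ?pTV_seminorm_ge0.
split; first by have [] := fg 1 ltr01.
apply/ler_addgt0Pr => e e0; have [_ /le_trans->//] := fg e e0.
by rewrite addrACA -splitr.
Qed.

Lemma pTV_seminorm0 : Up 0 /\ N 0 = 0.
Proof.
have U0 e : 0 < e -> Up 0 /\ N 0 <= e.
  by move=> e0; apply/pTV_boundP => //; apply: pTV_bound0; exact: ltW.
split; first by have [] := U0 1 ltr01.
apply/eqP; rewrite eq_le pTV_seminorm_ge0 andbT.
by apply/ler_addgt0Pr => e e0; rewrite add0r; have [] := U0 e e0.
Qed.

Lemma pTV_seminormZ_le c f : Up f -> Up (c *: f) /\ N (c *: f) <= `|c| * N f.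
Proof.
move=> Uf; have [->|c0] := eqVneq c 0.
  by rewrite scale0r normr0 mul0r; have [U0 ->] := pTV_seminorm0.
have nc0 : 0 < `|c| by rewrite normr_gt0.
(* The slack is divided by the norm of [c] so that exactly [e] remains after scaling. *)
have cf e : 0 < e -> Up (c *: f) /\ N (c *: f) <= `|c| * (N f + e / `|c|).
  move=> e0; have ec0 : 0 < e / `|c| by rewrite divr_gt0.
  apply/pTV_boundP => //; last by apply: pTV_boundZ; exact: pTV_bound_seminorm.
  by rewrite mulr_gt0// ltr_wpDl ?pTV_seminorm_ge0.
split; first by have [] := cf 1 ltr01.
apply/ler_addgt0Pr => e e0; have [_ /le_trans->//] := cf e e0.
by rewrite mulrDr mulrCA divff ?mulr1// gt_eqF.
Qed.

Lemma linear_subspace_Up : linear_subspace Up.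
Proof.
split=> [|c f g]; first by rewrite in_setE; exact: pTV_seminorm0.1.
rewrite !in_setE => Uf Ug.
by apply: (pTV_seminormD _ Ug).1; exact: (pTV_seminormZ_le c Uf).1.
Qed.

Lemma seminorm_on_pTV : seminorm_on Up N.
Proof.
split=> [f _|c f Uf|f g Uf Ug].
- exact: pTV_seminorm_ge0.
- have [Ucf cf] := pTV_seminormZ_le c Uf.
  have [->|c0] := eqVneq c 0.
    by rewrite scale0r normr0 mul0r; have [] := pTV_seminorm0.
  (* The reverse inequality is the same bound applied to the inverse of [c] and to [c *: f]. *)
  have [_] := pTV_seminormZ_le c^-1 Ucf.
  rewrite scalerA mulVf// scale1r normfV => fc.
  apply: le_anti; apply/andP; split; first exact: cf.
  by rewrite -ler_pdivlMl// normr_gt0.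
- exact: (pTV_seminormD Uf Ug).2.
Qed.

Lemma le_norm_TVp f s : Up f -> `|f s| <= 2 * TVp_norm ab p f.
Proof.
move=> Uf; apply/ler_addgt0Pr => e e0.
have e20 : 0 < e / 2 by rewrite divr_gt0.
have := pTV_bound_oscillation ab s (pTV_bound_seminorm Uf e20).
have := ler_normD (f s - f (Icc_left ab)) (f (Icc_left ab)).
rewrite subrK /TVp_norm; have := normr_ge0 (f (Icc_left ab)).
lra.
Qed.

Lemma norm_on_TVp : norm_on Up (TVp_norm ab p).
Proof.
have [q0 qZ qD] := seminorm_on_pTV.
split; first split=> [f Uf|c f Uf|f g Uf Ug].
- by rewrite addr_ge0 ?q0.
- by rewrite /TVp_norm qZ// normrZ mulrDr.
- by rewrite /TVp_norm addrACA lerD ?qD// ler_normD.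
- move=> f Uf f0; apply/funext => s; apply/eqP.
  by rewrite -normr_le0 (le_trans (le_norm_TVp s Uf))// f0 mulr0.
Qed.

End pTV_seminorm_theory.

(** * Completeness *)

Lemma norm_complete_TVp (R : realType) (W : completeNormedModType R) (a b : R)
    (ab : a < b) (p : R) :
  1 <= p -> norm_complete (Up W a b p) (TVp_norm ab p).
Proof.
move=> p1 F FF FU cF.
have subU : forall f g, Up W a b p f -> Up W a b p g -> Up W a b p (f - g).
  move=> f g Uf Ug; apply/set_mem.
  by apply: (GRing.submod_closedB (linear_subspace_Up W ab p1)).2; exact: mem_set.
have F_eval s : cauchy ((fun f : Icc a b -> W => f s) @ F).
  apply/cauchyP => e e0.
  (* The halving absorbs the factor 2 of [le_norm_TVp]. *)
  have [|f Uf Ff] := cF (e / 2); first by rewrite divr_gt0.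
  exists (f s); apply: (@filterS _ F _ _ _ _ (filterI FU Ff)) => h [Uh fh].
  rewrite -ball_normE /=.
  apply: le_lt_trans (le_norm_TVp ab p1 s (subU _ _ Uf Uh)) _.
  by move: fh => /=; lra.
have [g Fg] : exists g : Icc a b -> W, forall s, f s @[f --> F] --> g s.
  exists (fun s => lim ((fun f : Icc a b -> W => f s) @ F)) => s.
  exact: cauchy_cvg (F_eval s).
(* Pointwise limits in [f - h] bound the value at [a] and the seminorm by [e] separately, hence
   [e + e]. *)
have subg e f : 0 < e -> Up W a b p f -> F [set h | TVp_norm ab p (f - h) < e] ->
    Up W a b p (f - g) /\ TVp_norm ab p (f - g) <= e + e.
  move=> e0 Uf Ff.
  have fga : `|(f - g) (Icc_left ab)| <= e.
    apply: (@cvgr_to_le _ F _ _ (fun h => `|(f - h) (Icc_left ab)|)).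
      by apply: cvg_norm; apply: cvgB; [exact: cvg_cst|exact: Fg].
    apply: filterS Ff => h /= /ltW; apply: le_trans.
    by rewrite lerDl pTV_seminorm_ge0.
  suff /(pTV_boundP _ ab p1 e0)[Ufg Nfg] : pTV_bound p e (f - g).
    by split=> //; exact: lerD.
  have Ffg s : h s @[h --> (fun h => f - h) @ F] --> (f - g) s.
    by apply: cvgB; [exact: cvg_cst|exact: Fg].
  apply: (@pTV_bound_closed _ _ _ _ ((fun h => f - h) @ F) _ _ _ _ Ffg).
  apply: (@filterS _ F _ _ _ _ (filterI FU Ff)) => h [Uh fh] /=.
  apply/pTV_boundP => //; split; first exact: subU.
  by apply: le_trans (ltW fh); rewrite lerDr.
have [f1 Uf1 Ff1] := cF 1 ltr01.
(* Membership of the limit follows from [g = f1 - (f1 - g)]. *)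
have Ug : Up W a b p g.
  rewrite -[g](subKr f1); apply: subU => //.
  exact: (subg 1 f1 ltr01 Uf1 Ff1).1.
exists g => // e e0.
(* Going from [g] to [h] through [f] costs [e / 4] plus twice [e / 4], which is below [e]. *)
have e40 : 0 < e / 4 by rewrite divr_gt0.
have [f Uf Ff] := cF _ e40.
have [Ufg fg] := subg _ _ e40 Uf Ff.
apply: filterS (filterI FU Ff) => h [Uh /= fh].
have -> : g - h = (f - h) + (g - f) by rewrite [RHS]addrC addrA subrK.
have [[_ NZ ND] _] := norm_on_TVp W ab p1.
have gf : TVp_norm ab p (g - f) = TVp_norm ab p (f - g).
  by rewrite -opprB -scaleN1r NZ// normrN1 mul1r.
apply: le_lt_trans (ND _ _ (subU _ _ Uf Uh) (subU _ _ Ug Uf)) _.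
rewrite gf; apply: le_lt_trans (lerD (ltW fh) fg) _.
by move: e0; clear; lra.
Qed.

Theorem proposition1 (R : realType) (W : completeNormedModType R) (a b : R)
    (ab : a < b) (p : R) (p1 : 1 <= p) :
  [/\ linear_subspace (Up W a b p),
      seminorm_on (Up W a b p) (pTV_seminorm p),
      norm_on (Up W a b p) (TVp_norm ab p)
    & banach_on (Up W a b p) (TVp_norm ab p)].
Proof.
have lin := linear_subspace_Up W ab p1; have nrm := norm_on_TVp W ab p1.
split=> //; first exact: seminorm_on_pTV.
by apply: norm_complete_banach_on => //; exact: norm_complete_TVp.
Qed.
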